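(* If $\delta$ is a fuzzy topology on a set $X$, then the following conditions are equivalent. (a) $\delta$ is affine invariant. (b) $\delta$ is laminated and if $x\in U$ and $U\in\iota(\delta)$, then there exists $f\in\delta$ such that $f(x)=1$ and $f|(X\setminus U)=0$. (c) $\delta$ is laminated and if $U\in\iota(\delta)$, then $\chi_U\in\delta$, where $\chi_U$ is the characteristic function of $U$. (d) $\delta=\omega(\iota(\delta))$. (e) $\delta$ is topological, i.e. $\delta$ is induced from some topology $\tau$ on $X$.
   Context: Let $I=[0,1]\subset\mathbb{R}$, and for a set $X$ let $I^X$ be the set of all functions $X\to I$, with pointwise suprema $\bigvee$ and infima $\bigwedge$. All index sets are assumed nonempty. A subset $\delta\subset I^X$ is a fuzzy topology on $X$ if: (i) the constant functions $0,1$ are in $\delta$; (ii) $\bigvee_{i\in K} f_i\in\delta$ for every indexed family $\{f_i:i\in K\}$ in $\delta$; (iii) $\bigwedge_{i\in K} f_i\in\delta$ for every finite indexed family $\{f_i : i\in K\}$ in $\delta$. It is laminated if moreover (i') every constant function $k$ with $k\in I$ is in $\delta$. It is affine invariant if (ii) and (iii) hold and (i) is replaced by: (i'') the constant function $0$ is in $\delta$, and whenever $f\in\delta$, $m,k\in\mathbb{R}$ with $m>0$, and $g=m\cdot f+k$ satisfies $g(x)\in I$ for all $x\in X$, then $g\in\delta$ (this implies (i') and (i)). For $f:X\to\mathbb{R}$ and $c\in\mathbb{R}$ write $f_{(c}=f^{-1}(c,\infty)$. For a topology $\tau$ on $X$, $\omega(\tau)=\{f\in I^X : f_{(c}\in\tau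 \text{ for all } c\in I\}$, the set of lower semicontinuous functions from $(X,\tau)$ to $I$. For a fuzzy topology $\delta$ on $X$, $\iota(\delta)$ is the topology on $X$ with subbase $\{f_{(c} : c\in I,\ f\in\delta\}$. A fuzzy topology $\delta$ is induced from the topology $\tau$ when $\delta=\omega(\tau)$. The characteristic function $\chi_U$ equals $1$ on $U$ and $0$ on $X\setminus U$. *)

(* Defs.v *)
From mathcomp Require Import all_boot all_order all_algebra.
From mathcomp Require Import finmap.
From mathcomp Require Import all_classical all_reals all_analysis.

Set Implicit Arguments.
Unset Strict Implicit.
Unset Printing Implicit Defensive.

Import Order.TTheory GRing.Theory Num.Theory.

Local Open Scope classical_set_scope.
Local Open Scope ring_scope.

Definition unit_itv (R : realType) : set R := `[0, 1].

(* I^X, as the set of the f : X -> R with values in [0, 1]. *)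
Definition unit_valued (X : Type) (R : realType) : set (X -> R) :=
  [set f | forall x, unit_itv (f x)].

Definition pointwise_sup (X K : Type) (R : realType) (f : K -> X -> R) : X -> R :=
  fun x => sup (range (fun i => f i x)).

Definition pointwise_inf (X K : Type) (R : realType) (f : K -> X -> R) : X -> R :=
  fun x => inf (range (fun i => f i x)).

(* Index types are required to be inhabited; [sup] and [inf] then have their
   usual meaning, the families considered being [0, 1]-valued. *)
Definition sup_closed (X : Type) (R : realType) (delta : set (X -> R)) : Prop :=
  forall (K : Type) (f : K -> X -> R), inhabited K ->
    (forall i, delta (f i)) -> delta (pointwise_sup f).

Definition fin_inf_closed (X : Type) (R : realType) (delta : set (X -> R)) : Prop :=
  forall (K : finType) (f : K -> X -> R), inhabited K ->
    (forall i, delta (f i)) -> delta (pointwise_inf f).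

Record fuzzy_topology (X : Type) (R : realType) (delta : set (X -> R)) : Prop :=
  FuzzyTopology {
    fuzzy_unit_valued : delta `<=` @unit_valued X R ;
    fuzzy_cst0 : delta (cst 0) ;
    fuzzy_cst1 : delta (cst 1) ;
    fuzzy_sup : sup_closed delta ;
    fuzzy_inf : fin_inf_closed delta }.

Definition laminated (X : Type) (R : realType) (delta : set (X -> R)) : Prop :=
  fuzzy_topology delta /\ forall k : R, unit_itv k -> delta (cst k).

Record affine_invariant (X : Type) (R : realType) (delta : set (X -> R)) : Prop :=
  AffineInvariant {
    affine_unit_valued : delta `<=` @unit_valued X R ;
    affine_cst0 : delta (cst 0) ;
    affine_map : forall (f : X -> R) (m k : R), delta f -> 0 < m ->
      unit_valued (fun x => m * f x + k) -> delta (fun x => m * f x + k) ;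
    affine_sup : sup_closed delta ;
    affine_inf : fin_inf_closed delta }.

(* The preimage of ]c, +oo[ under f. *)
Definition upper_level (X : Type) (R : realType) (f : X -> R) (c : R) : set X :=
  f @^-1` [set` `]c, +oo[].

(* The fields are those of [isOpenTopological]; a predicate on families of
   sets is used because topologies on a fixed bare type are quantified over.
   The empty union is allowed, so that [set0] is open. *)
Record is_topology (X : Type) (tau : set (set X)) : Prop := IsTopology {
  topologyT : tau setT ;
  topologyI : setI_closed tau ;
  topology_bigcup : forall (K : Type) (U : K -> set X),
    (forall i, tau (U i)) -> tau (\bigcup_i U i) }.

Definition omega_fuzzy (X : Type) (R : realType) (tau : set (set X)) : set (X -> R) :=
  [set f | unit_valued f /\ forall c : R, unit_itv c -> tau (upper_level f c)].

Definition iota_subbase (X : Type) (R : realType) (delta : set (X -> R)) :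
    set (set X) :=
  [set U | exists f c, [/\ delta f, unit_itv c & U = upper_level f c]].

(* Unions of finite intersections of members of the subbase, the empty
   intersection being [setT]. *)
Definition iota_topology (X : Type) (R : realType) (delta : set (X -> R)) :
    set (set X) :=
  [set \bigcup_(U in D) U | D in
    subset^~ (finI_from (iota_subbase delta) id)].

Definition is_topological (X : Type) (R : realType) (delta : set (X -> R)) : Prop :=
  exists2 tau : set (set X), is_topology tau & delta = @omega_fuzzy X R tau.

Lemma iota_topologyP (X : Type) (R : realType) (delta : set (X -> R)) :
  is_topology (iota_topology delta).
Proof.
split.
- exists [set setT]; last by rewrite bigcup_set1.
  move=> _ ->; exists fset0 => //.
  by rewrite predeqE.
- move=> _ _ [A sA <-] [B sB <-].
  exists [set W | exists V V', [/\ A V, B V' & W = V `&` V']].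
    move=> _ [V [V' [/sA [F sF <-] /sB [F' sF' <-] ->]]].
    exists (F `|` F')%fset.
      by move=> W; rewrite inE => /orP[/sF|/sF'].
    by rewrite set_fsetU bigcap_setU.
  apply/seteqP; split=> x.
    by move=> [_ [V [V' [AV BV' ->]]]] [Vx V'x]; split; [exists V|exists V'].
  move=> [[V AV Vx] [V' BV' V'x]]; exists (V `&` V') => //.
  by exists V, V'.
- move=> K U HU.
  pose A := [set W | finI_from (iota_subbase delta) id W /\
                     exists i, W `<=` U i].
  exists A; first by move=> W [].
  apply/seteqP; split=> x.
    by move=> [W [_ [i WU]] Wx]; exists i => //; exact: WU.
  move=> [i _ Uix]; have [D sD UE] := HU i.
  move: Uix; rewrite -UE => -[W DW Wx]; exists W => //.
  split; first exact: sD.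
  by exists i => y Wy; rewrite -UE; exists W.
Qed.

Lemma open_is_topology (T : topologicalType) : is_topology (@open T).
Proof.
split; [exact: openT | exact: openI | move=> K U HU].
by apply: bigcup_open => i _; exact: HU.
Qed.

(* Main.v *)
(** The affine maps normalise a truncation of f between c and f x to a
    function that is 1 at x and 0 off the upper level set of f at c; finite
    minima of these handle the basic open sets of iota(delta).
    Being closed under suprema, delta contains every function that is
    approximated from below at each point by members of delta lying under it:
    this yields the characteristic functions, and then, using the functions
    min(c, chi_(f > c)), every lower semicontinuous f. *)
Require Import Defs.
From mathcomp Require Import all_boot all_order all_algebra.
From mathcomp Require Import finmap.
From mathcomp Require Import all_classical all_reals all_analysis.
From mathcomp Require Import lra.

Import Order.TTheory GRing.Theory Num.Theory.

Local Open Scope classical_set_scope.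
Local Open Scope ring_scope.

Lemma unit_itvP (R : realType) (k : R) : unit_itv k <-> 0 <= k <= 1.
Proof. by rewrite /unit_itv /= in_itv. Qed.

Lemma upper_levelE (X : Type) (R : realType) (f : X -> R) (c : R) :
  upper_level f c = [set x | c < f x].
Proof.
rewrite /upper_level; apply/seteqP; split=> x /=; by rewrite in_itv /= andbT.
Qed.

Lemma topology0 (X : Type) (tau : set (set X)) : is_topology tau -> tau set0.
Proof.
move=> tauP; have := topology_bigcup tauP (U := fun _ : void => set0).
by rewrite bigcup0 //; apply; case.
Qed.

Lemma iota_upper_level {X : Type} {R : realType} {delta : set (X -> R)}
    {f : X -> R} {c : R} :
  delta f -> unit_itv c -> iota_topology delta (upper_level f c).
Proof.
move=> df Ic; exists [set upper_level f c]; last by rewrite bigcup_set1.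
move=> _ ->; exists [fset upper_level f c]%fset.
  by move=> U; rewrite inE => /eqP ->; rewrite inE; exists f, c.
by rewrite set_fset1 bigcap_set1.
Qed.

Section FuzzyTopology.
Context {X : Type} {R : realType} {delta : set (X -> R)}.
Hypothesis deltaP : fuzzy_topology delta.

Lemma fuzzy_ge0_le1 {f : X -> R} (x : X) : delta f -> 0 <= f x <= 1.
Proof. by move=> df; apply/unit_itvP; exact: (fuzzy_unit_valued deltaP df). Qed.

Lemma fuzzy_min {f g : X -> R} : delta f -> delta g -> delta (f \min g).
Proof.
move=> df dg.
have -> : f \min g = pointwise_inf (fun b : bool => if b then f else g).
  apply/funext => x; rewrite /pointwise_inf.
  have -> : range (fun b : bool => (if b then f else g) x) = [set f x; g x].
    apply/seteqP; split=> y.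
      by move=> [[] _ <-]; [left|right].
    by move=> [] ->; [exists true|exists false].
  apply/eqP; rewrite eq_le; apply/andP; split.
    apply: lb_le_inf; first by exists (f x); left.
    by move=> y [] ->; rewrite /= ge_min lexx // orbT.
  have hlb : has_lbound [set f x; g x].
    by exists (Num.min (f x) (g x)) => y [] ->; rewrite ge_min lexx // orbT.
  by rewrite /= le_min; apply/andP; split; apply: ge_inf => //; [left|right].
by apply: (fuzzy_inf deltaP) => [|[]]; first exact: (inhabits true).
Qed.

(** The supremum of all members of [delta] lying under [f] is [f] itself. Nonnegativity of [f] puts
    the constant 0 in this family, so that the index type is inhabited. *)
Lemma fuzzy_approx {f : X -> R} : (forall x, 0 <= f x) ->
  (forall x c, 0 <= c < f x ->
     exists g, [/\ delta g, forall y, g y <= f y & c <= g x]) ->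
  delta f.
Proof.
move=> f0 happ.
pose K := {g : X -> R | delta g /\ forall y, g y <= f y}.
pose k0 : K := exist _ (cst 0) (conj (fuzzy_cst0 deltaP) f0).
have -> : f = pointwise_sup (fun k : K => sval k).
  apply/funext => x; rewrite /pointwise_sup; apply/eqP; rewrite eq_le.
  have fub : ubound (range (fun k : K => sval k x)) (f x).
    by move=> _ [[g [dg gf]] _ <-]; exact: gf.
  apply/andP; split; last by apply: ge_sup => //; exists 0, k0.
  have le_sup (k : K) : sval k x <= sup (range (fun k : K => sval k x)).
    by apply: ub_le_sup; [exists (f x)|exists k].
  rewrite leNgt; apply/negP => sf.
  have s0 := le_sup k0.
  set s := sup _ in sf s0 le_sup.
  (* If [s < f x], the midpoint is still below [f x], and nonnegative because [k0] gives [0 <= s];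
     an approximant reaching it would exceed the supremum [s]. *)
  have [|g [dg gf cg]] := happ x ((s + f x) / 2).
    by rewrite /= in s0; apply/andP; split; lra.
  have := le_sup (exist _ g (conj dg gf)) => /= gs; lra.
by apply: (fuzzy_sup deltaP) => [|[g []]//]; exact: (inhabits k0).
Qed.

Lemma fuzzy_max {f g : X -> R} : delta f -> delta g -> delta (f \max g).
Proof.
move=> df dg; apply: fuzzy_approx => [x|x c /andP[_]] /=.
  by have /andP[f0 _] := fuzzy_ge0_le1 x df; rewrite le_max f0.
rewrite lt_max => /orP[/ltW cf|/ltW cg].
  by exists f; split => // y; rewrite le_max lexx.
by exists g; split => // y; rewrite le_max lexx orbT.
Qed.

(** Take the minimum of the separating functions: as members of [delta] are nonnegative, it vanishes
    wherever one of them does. The empty intersection is served by the constant 1. *)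
Lemma separated_bigcap (x : X) (F : {fset set X}) :
  (forall V, V \in F ->
     exists2 f, delta f & f x = 1 /\ forall y, ~ V y -> f y = 0) ->
  exists2 f, delta f &
    f x = 1 /\ forall y, ~ (\bigcap_(V in [set` F]) V) y -> f y = 0.
Proof.
move=> sepF; rewrite bigcap_fset big_seq.
elim/big_ind: _ => [|A B [f df [fx f0]] [g dg [gx g0]]|V /sepF//].
  by exists (cst 1); [exact: fuzzy_cst1 deltaP|split=> // y []].
exists (f \min g); first exact: fuzzy_min.
split=> [|y /not_andP[/f0|/g0] y0] /=; first by rewrite fx gx minxx.
  by have /andP[? _] := fuzzy_ge0_le1 y dg; rewrite y0; apply/min_idPl.
by have /andP[? _] := fuzzy_ge0_le1 y df; rewrite y0; apply/min_idPr.
Qed.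

(** A function separating a point of [U] from the complement lies under the indicator, being at most
    1 everywhere and 0 off [U], and attains it at that point. *)
Lemma fuzzy_indic (U : set X) :
  (forall x, U x -> exists2 f, delta f & f x = 1 /\ forall y, ~ U y -> f y = 0) ->
  delta \1_U.
Proof.
move=> sepU; apply: fuzzy_approx => [x|x c]; first by rewrite indicE ler0n.
rewrite indicE; have [/set_mem Ux /andP[_ /ltW c1]|_ /andP[c0 cl0]] := boolP (x \in U);
  last by move: (le_lt_trans c0 cl0); rewrite ltxx.
have [f df [fx f0]] := sepU x Ux; exists f; split => //; last by rewrite fx.
move=> y; rewrite indicE; have [_|/negP nUy] := boolP (y \in U).
  by have /andP[] := fuzzy_ge0_le1 y df.
by rewrite f0 // => Uy; apply: nUy; rewrite inE.
Qed.

Lemma omega_iota :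
  laminated delta -> (forall U, iota_topology delta U -> delta \1_U) ->
  delta = omega_fuzzy (iota_topology delta).
Proof.
move=> [_ dcst] dindic; apply/seteqP; split=> f.
  move=> df; split; first exact: fuzzy_unit_valued deltaP _ df.
  by move=> c; exact: iota_upper_level.
move=> [fI fopen]; have {}fI x : 0 <= f x <= 1 by apply/unit_itvP; exact: fI.
apply: fuzzy_approx => [x|x c /andP[c0 cf]]; first by case/andP: (fI x).
have Ic : unit_itv c.
  by apply/unit_itvP; have /andP[_ f1] := fI x; apply/andP; split; lra.
(* This is [c], hence less than [f], on the level set and 0 off it; at [x] it equals [c]. *)
exists (cst c \min \1_(upper_level f c)); split.
- by apply: fuzzy_min; [exact: dcst|apply: dindic; exact: fopen].
- move=> y /=; rewrite indicE upper_levelE ge_min.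
  have [/set_mem /ltW -> //|_] := boolP (y \in _).
  by case/andP: (fI y) => ->; rewrite orbT.
- rewrite /= indicE upper_levelE mem_set //= le_min lexx /=.
  by case/unit_itvP/andP: Ic.
Qed.

End FuzzyTopology.

Section AffineInvariant.
Context {X : Type} {R : realType} {delta : set (X -> R)}.
Hypotheses (deltaP : fuzzy_topology delta) (deltaA : affine_invariant delta).

Lemma affine_laminated : laminated delta.
Proof.
split=> // k Ik.
have -> : cst k = (fun x : X => 1 * cst 0 x + k) :> (X -> R).
  by apply/funext => x /=; rewrite mulr0 add0r.
apply: (affine_map deltaA); [exact: affine_cst0 deltaA|exact: ltr01|].
by move=> x /=; rewrite mulr0 add0r.
Qed.

Lemma affine_separated_upper_level (f : X -> R) (c : R) (x : X) :
  delta f -> unit_itv c -> c < f x ->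
  exists2 g, delta g & g x = 1 /\ forall y, ~ upper_level f c y -> g y = 0.
Proof.
move=> df Ic cf; have [_ dcst] := affine_laminated.
have Ifx : unit_itv (f x) by apply/unit_itvP; exact: (fuzzy_ge0_le1 deltaP x df).
(* An affine image of [f] itself could leave [0, 1]. Truncation to the interval from [c] to [f x]
   prevents this: the map taking [c] to 0 and [f x] to 1 then has values in [0, 1]. *)
pose h := (f \max cst c) \min cst (f x).
have dh : delta h.
  exact: (fuzzy_min deltaP (fuzzy_max deltaP df (dcst _ Ic)) (dcst _ Ifx)).
have d0 : 0 < f x - c by rewrite subr_gt0.
have hc y : c <= h y <= f x.
  by rewrite /h /= le_min le_max lexx orbT (ltW cf) ge_min lexx orbT.
have gE y : (f x - c)^-1 * h y + - (c / (f x - c)) = (h y - c) / (f x - c).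
  by rewrite mulrBl [_^-1 * _]mulrC.
exists (fun y => (f x - c)^-1 * h y + - (c / (f x - c))).
  apply: (affine_map deltaA) => //; first by rewrite invr_gt0.
  move=> y; apply/unit_itvP; have /andP[h1 h2] := hc y.
  by rewrite gE ler_pdivlMr // mul0r ler_pdivrMr // mul1r; apply/andP; split; lra.
split=> [|y]; rewrite gE /h /=.
  by rewrite (max_idPl (ltW cf)) minxx divff // gt_eqF.
rewrite upper_levelE /= => /negP; rewrite -leNgt => fyc.
by rewrite (max_idPr fyc) (min_idPl (ltW cf)) subrr mul0r.
Qed.

(** Some finite intersection of subbasic sets contains [x] and lies in [U]; a function vanishing off
    that intersection vanishes off [U]. *)
Lemma affine_separated (x : X) (U : set X) : U x -> iota_topology delta U ->
  exists2 f, delta f & f x = 1 /\ forall y, ~ U y -> f y = 0.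
Proof.
move=> Ux [D sD UE]; move: Ux; rewrite -UE => -[W DW Wx].
have [F sF WE] := sD _ DW.
have [V /[dup] VF /sF|f df [fx f0]] := separated_bigcap deltaP x F.
  rewrite inE => -[f [c [df Ic VE]]].
  have : V x by move: Wx; rewrite -WE; exact.
  by rewrite VE {1}upper_levelE; exact: affine_separated_upper_level.
exists f => //; split=> // y nUy; apply: f0 => Wy; apply: nUy.
by exists W => //; rewrite -WE.
Qed.

End AffineInvariant.

Lemma omega_affine {X : Type} {R : realType} {tau : set (set X)}
    {f : X -> R} {m k : R} : is_topology tau ->
  omega_fuzzy tau f -> 0 < m -> unit_valued (fun x => m * f x + k) ->
  omega_fuzzy tau (fun x => m * f x + k).
Proof.
move=> tauP [fI fopen] m0 gI; split=> // c _.
have -> : upper_level (fun x => m * f x + k) c = upper_level f ((c - k) / m).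
  rewrite !upper_levelE; apply/seteqP; split=> x /=;
    by rewrite ltr_pdivrMr // [f x * m]mulrC ltrBlDr.
(* The new threshold may leave [0, 1], where [fopen] says nothing; the level set is then the whole
   space or empty, since [f] has values in [0, 1]. *)
set d := (c - k) / m.
have {}fI x : 0 <= f x <= 1 by apply/unit_itvP; exact: fI.
have [d0|d0] := ltP d 0.
  suff -> : upper_level f d = setT by exact: topologyT.
  apply/seteqP; split=> // x _; rewrite upper_levelE /=.
  by case/andP: (fI x) => f0 _; exact: lt_le_trans f0.
have [d1|d1] := leP d 1; first by apply: fopen; apply/unit_itvP/andP.
suff -> : upper_level f d = set0 by exact: topology0.
apply/seteqP; split=> // x; rewrite upper_levelE /=.
by case/andP: (fI x) => _ f1; rewrite ltNge (le_trans f1 (ltW d1)).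
Qed.

Theorem theorem1p5 (R : realType) (X : Type) (delta : set (X -> R))
    (hdelta : fuzzy_topology delta) :
  [<-> (* (a) *) affine_invariant delta ;
       (* (b) *) laminated delta /\
                 forall (x : X) (U : set X), U x -> iota_topology delta U ->
                   exists2 f : X -> R, delta f &
                     f x = 1 /\ (forall y : X, ~ U y -> f y = 0) ;
       (* (c) *) laminated delta /\
                 forall U : set X, iota_topology delta U -> delta (\1_U) ;
       (* (d) *) delta = omega_fuzzy (iota_topology delta) ;
       (* (e) *) is_topological delta ].
Proof.
tfae.
- move=> deltaA; split; first exact: affine_laminated.
  by move=> x U; exact: affine_separated.
- move=> [dl sep]; split=> // U iU; apply: fuzzy_indic => // x Ux.
  exact: sep.
- by move=> [dl dindic]; exact: omega_iota.
- by move=> dE; exists (iota_topology delta); first exact: iota_topologyP.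
(* Only the affine field needs [tau]; the others are already part of [hdelta]. *)
- move=> [tau tauP dE]; split.
  + exact: fuzzy_unit_valued.
  + exact: fuzzy_cst0.
  + by move=> f m k; rewrite {}dE; exact: omega_affine.
  + exact: fuzzy_sup.
  + exact: fuzzy_inf.
Qed.
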